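(* Let $D\ge2$ be squarefree and $K=\mathbb{Q}(\sqrt D)$ with discriminant $\Delta$. If $\alpha\in\mathcal{O}_K^+$ is uniquely decomposable, then \[N(\alpha)<\sqrt\Delta\bigl(2\sqrt\Delta+1\bigr)\bigl(3\sqrt\Delta+2\bigr).\]
   Context: $\mathcal{O}_K$ is the ring of integers of $K$, $\alpha'$ the Galois conjugate of $\alpha$, $N(\alpha)=\alpha\alpha'$. $\Delta=4D$ if $D\equiv2,3\pmod4$ and $\Delta=D$ if $D\equiv1\pmod4$. $\mathcal{O}_K^+$ is the set of $\alpha\in\mathcal{O}_K$ with $\alpha>0$ and $\alpha'>0$; $\alpha\in\mathcal{O}_K^+$ is indecomposable if it cannot be written as a sum of two elements of $\mathcal{O}_K^+$, and uniquely decomposable if there is exactly one way (up to order of summands) to write it as a sum of indecomposable elements. *)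

(* Defs.v *)
From HB Require Import structures.
From mathcomp Require Import all_boot all_order all_algebra.
From mathcomp Require Import reals.
From mathcomp Require Import ring.

Set Implicit Arguments.
Unset Strict Implicit.
Unset Printing Implicit Defensive.

Import Order.TTheory GRing.Theory Num.Theory.
Local Open Scope ring_scope.

Definition squarefree (n : nat) : Prop :=
  forall p : nat, prime p -> ~~ (p ^ 2 %| n)%N.

(* The discriminant of Q(sqrt D), for D squarefree (so that 4 does not
   divide D, and the second branch is D = 2, 3 mod 4). *)
Definition disc (D : nat) : nat := if (D %% 4 == 1)%N then D else (4 * D)%N.

(* K = Q(sqrt D): Quad a b stands for a + b sqrt D. Two such elements are equal
   iff their coordinates are, so this is Q(sqrt D) only when D is not a square;
   see quadfield_inv and qemb_inj below. *)
Record quadfield (D : nat) := Quad { qrat : rat; qirr : rat }.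

Section QuadField.
Variable D : nat.
Local Notation K := (quadfield D).

Definition quad_to_pair (x : K) : rat * rat := (qrat x, qirr x).
Definition quad_of_pair (p : rat * rat) : K := Quad D p.1 p.2.

Lemma quad_to_pairK : cancel quad_to_pair quad_of_pair.
Proof. by case. Qed.

HB.instance Definition _ := Choice.copy K (can_type quad_to_pairK).

Lemma quad_eqP (x y : K) : qrat x = qrat y -> qirr x = qirr y -> x = y.
Proof. by case: x y => [a b] [c d] /= -> ->. Qed.

Definition quad_zero : K := Quad D 0 0.
Definition quad_one : K := Quad D 1 0.
Definition quad_opp (x : K) : K := Quad D (- qrat x) (- qirr x).
Definition quad_add (x y : K) : K :=
  Quad D (qrat x + qrat y) (qirr x + qirr y).
Definition quad_mul (x y : K) : K :=
  Quad D (qrat x * qrat y + D%:R * (qirr x * qirr y))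
         (qrat x * qirr y + qirr x * qrat y).

Lemma quad_addA : associative quad_add.
Proof. by move=> x y z; apply: quad_eqP => /=; ring. Qed.
Lemma quad_addC : commutative quad_add.
Proof. by move=> x y; apply: quad_eqP => /=; ring. Qed.
Lemma quad_add0 : left_id quad_zero quad_add.
Proof. by move=> x; apply: quad_eqP => /=; ring. Qed.
Lemma quad_addN : left_inverse quad_zero quad_opp quad_add.
Proof. by move=> x; apply: quad_eqP => /=; ring. Qed.

HB.instance Definition _ :=
  GRing.isZmodule.Build K quad_addA quad_addC quad_add0 quad_addN.

Lemma quad_mulA : associative quad_mul.
Proof. by move=> x y z; apply: quad_eqP => /=; ring. Qed.
Lemma quad_mulC : commutative quad_mul.
Proof. by move=> x y; apply: quad_eqP => /=; ring. Qed.
Lemma quad_mul1 : left_id quad_one quad_mul.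
Proof. by move=> x; apply: quad_eqP => /=; ring. Qed.
Lemma quad_mulDl : left_distributive quad_mul quad_add.
Proof. by move=> x y z; apply: quad_eqP => /=; ring. Qed.
Lemma quad_one_neq0 : quad_one != quad_zero.
Proof. by []. Qed.

HB.instance Definition _ := GRing.Zmodule_isComNzRing.Build K
  quad_mulA quad_mulC quad_mul1 quad_mulDl quad_one_neq0.

Definition qconj (x : K) : K := Quad D (qrat x) (- qirr x).

Lemma qconj_is_zmod_morphism : zmod_morphism qconj.
Proof. by move=> x y; apply: quad_eqP => //=; ring. Qed.
Lemma qconj_is_monoid_morphism : monoid_morphism qconj.
Proof. by split=> [|x y]; apply: quad_eqP => //=; ring. Qed.

HB.instance Definition _ :=
  GRing.isZmodMorphism.Build K K qconj qconj_is_zmod_morphism.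
HB.instance Definition _ :=
  GRing.isMonoidMorphism.Build K K qconj qconj_is_monoid_morphism.

Definition qnorm (x : K) : K := x * qconj x.

Definition in_OK (x : K) : Prop := integralOver (intr : int -> K) x.

Section Embedding.
Variable R : realType.

Definition qemb (x : K) : R :=
  ratr (qrat x) + ratr (qirr x) * Num.sqrt D%:R.

Lemma qemb_is_zmod_morphism : zmod_morphism qemb.
Proof. by move=> x y; rewrite /qemb /= !rmorphD !rmorphN /=; ring. Qed.
Lemma qemb_is_monoid_morphism : monoid_morphism qemb.
Proof.
split=> [|x y]; first by rewrite /qemb /= rmorph1 rmorph0; ring.
rewrite /qemb; set s : R := Num.sqrt D%:R.
have s2 : D%:R = s ^+ 2 by rewrite sqr_sqrtr ?ler0n.
rewrite /= !rmorphD !rmorphM /= ratr_nat s2; ring.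
Qed.

HB.instance Definition _ :=
  GRing.isZmodMorphism.Build K R qemb qemb_is_zmod_morphism.
HB.instance Definition _ :=
  GRing.isMonoidMorphism.Build K R qemb qemb_is_monoid_morphism.

Definition in_OKplus (x : K) : Prop :=
  [/\ in_OK x, 0 < qemb x & 0 < qemb (qconj x)].

Definition indecomposable (x : K) : Prop :=
  in_OKplus x /\
  ~ exists y z : K, [/\ in_OKplus y, in_OKplus z & x = y + z].

(* A decomposition is a finite multiset of indecomposables, represented by a
   sequence up to perm_eq; a sum may consist of a single term. *)
Definition is_decomposition (x : K) (s : seq K) : Prop :=
  (forall y, y \in s -> indecomposable y) /\ \sum_(y <- s) y = x.

Definition uniquely_decomposable (x : K) : Prop :=
  exists s : seq K, is_decomposition x s /\
    forall t : seq K, is_decomposition x t -> perm_eq s t.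

End Embedding.

Lemma nat_sqr_squarefree : (1 < D)%N -> squarefree D ->
  forall m n : nat, (m ^ 2 = D * n ^ 2)%N -> n = 0%N.
Proof.
move=> D1 sqfD m n e; apply/eqP; rewrite -leqn0 leqNgt; apply/negP => n0.
have D0 : (0 < D)%N by exact: ltnW.
have pp := pdiv_prime D1; set p := pdiv D in pp.
have lD : logn p D = 1%N.
  apply/eqP; rewrite eqn_leq; apply/andP; split.
    by rewrite leqNgt -pfactor_dvdn //; exact: sqfD.
  by rewrite logn_gt0 mem_primes pp D0 pdiv_dvd.
have := congr1 (fun k => odd (logn p k)) e.
by rewrite /= lognM ?expn_gt0 ?n0 // !lognX lD oddD !oddM.
Qed.

Lemma rat_sqr_squarefree : (1 < D)%N -> squarefree D ->
  forall a b : rat, a ^+ 2 = D%:R * b ^+ 2 -> b = 0.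
Proof.
move=> D1 sqfD a b e.
have da : (denq a)%:~R != 0 :> rat by rewrite intr_eq0 denq_eq0.
have db : (denq b)%:~R != 0 :> rat by rewrite intr_eq0 denq_eq0.
have eZ : (numq a * denq b) ^+ 2 = D%:Z * (numq b * denq a) ^+ 2.
  apply/eqP; rewrite -(eqr_int rat) !(expr2, intrM).
  move: e; rewrite -{1}(divq_num_den a) -{1}(divq_num_den b) => e.
  apply/eqP.
  transitivity (((numq a)%:~R / (denq a)%:~R) ^+ 2
                * ((denq a)%:~R * (denq b)%:~R) ^+ 2 : rat); first by field.
  by rewrite e -pmulrn; field.
have := congr1 absz eZ; rewrite !(abszM, abszX) /= => /nat_sqr_squarefree.
move=> /(_ D1 sqfD) /eqP; rewrite muln_eq0 !absz_eq0 denq_eq0 orbF.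
by rewrite numq_eq0 => /eqP.
Qed.

Lemma quadfield_inv : (1 < D)%N -> squarefree D ->
  forall x : K, x != 0 -> exists y : K, x * y = 1.
Proof.
move=> D1 sqfD x x0.
set N : rat := qrat x ^+ 2 - D%:R * qirr x ^+ 2.
have N0 : N != 0.
  apply: contraNneq x0 => /eqP; rewrite subr_eq0 => /eqP e.
  have b0 := rat_sqr_squarefree D1 sqfD e.
  have a0 : qrat x = 0.
    by apply/eqP; rewrite -sqrf_eq0 e b0 expr0n mulr0.
  by apply/eqP; apply: quad_eqP.
exists (Quad D (qrat x / N) (- qirr x / N)).
by apply: quad_eqP => /=; rewrite /N; field.
Qed.

Lemma qemb_inj (R : realType) : (1 < D)%N -> squarefree D ->
  injective (@qemb R).
Proof.
move=> D1 sqfD x y e; apply/eqP; rewrite -subr_eq0; apply/negPn/negP => d0.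
have [z /(congr1 (@qemb R))] := quadfield_inv D1 sqfD d0.
rewrite rmorphM rmorphB rmorph1 /= e subrr mul0r => /eqP.
by rewrite eq_sym oner_eq0.
Qed.

End QuadField.

(* Main.v *)
(* Call [area x y = y x' - x y'], an integer multiple of [s = sqrt Delta].  An
   indecomposable [x] is primitive, so it has a [y] with [area x y = s], and
   translating [y] by multiples of [x] puts it next to [x]: this gives
   [4 N x <= s ^ 2], and if [x] occurs [m] times in a unique decomposition then
   [(m - 1) N x <= s], since otherwise [m x = y + (m x - y)] is another splitting.
   Two distinct summands [x], [y] of a unique decomposition form a lattice basis,
   as otherwise [x + y] splits through a lattice point of their parallelogram;
   hence there are at most two of them, and the norm of [m x + n y] is bounded by
   [(1 + s) s (2 s + 5)], which is smaller than the claimed bound. *)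

From HB Require Import structures.
Require Import Defs.
From mathcomp Require Import all_boot all_order all_algebra.
From mathcomp Require Import reals.
From mathcomp Require Import boolp.
From mathcomp Require Import all_field.
From mathcomp Require Import ring lra zify.
Import Order.TTheory GRing.Theory Num.Theory.
Local Open Scope ring_scope.

(** * The ring of integers as the lattice [Z + Z omega] *)

(** In lowest terms the squared denominator of [r] is coprime to the squared numerator, so it
    divides [D]; a prime factor of the denominator would contradict squarefreeness. *)
Lemma rat_int_of_squarefree_sqr (D : nat) (r : rat) :
  squarefree D -> D%:R * r ^+ 2 \is a Num.int -> r \is a Num.int.
Proof.
move=> sqfD /intrP[m em].
have d0 : (denq r)%:~R != 0 :> rat by rewrite intr_eq0 denq_eq0.
have eZ : D%:Z * numq r ^+ 2 = m * denq r ^+ 2.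
  apply/eqP; rewrite -(eqr_int rat) !(expr2, intrM) -pmulrn -em; apply/eqP.
  have er := divq_num_den r; rewrite -[X in D%:R * X ^+ 2]er. by field.
have eN : (D * `|numq r| ^ 2 = `|m| * `|denq r| ^ 2)%N.
  by have := congr1 absz eZ; rewrite !(abszM, abszX).
have dvdD : (`|denq r| ^ 2 %| D)%N.
  have : (`|denq r| ^ 2 %| D * `|numq r| ^ 2)%N by rewrite eN dvdn_mull.
  by rewrite Gauss_dvdl // coprimeXl // coprimeXr // coprime_sym coprime_num_den.
rewrite Qint_def -absz_denq eqz_nat.
have := absz_denq r; have [//|d_neq1] := eqVneq `|denq r|%N 1%N.
have d_gt1 : (1 < `|denq r|)%N by have := denq_gt0 r; lia.
have := sqfD _ (pdiv_prime d_gt1).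
by rewrite (dvdn_trans _ dvdD) // dvdn_exp2r // pdiv_dvd.
Qed.

(** Embedding into the algebraic numbers, where integral elements land in [Aint] and a rational
    member of [Aint] is an integer. *)
Definition qembC {D : nat} (x : quadfield D) : algC :=
  ratr (qrat x) + ratr (qirr x) * sqrtC D%:R.

Lemma qembC_is_zmod_morphism D : zmod_morphism (@qembC D).
Proof. by move=> x y; rewrite /qembC /= !rmorphD !rmorphN /=; ring. Qed.

Lemma qembC_is_monoid_morphism D : monoid_morphism (@qembC D).
Proof.
split=> [|x y]; first by rewrite /qembC /= rmorph1 rmorph0; ring.
rewrite /qembC; set s : algC := sqrtC D%:R.
have s2 : D%:R = s ^+ 2 by rewrite sqrtCK.
rewrite /= !rmorphD !rmorphM /= ratr_nat s2; ring.
Qed.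

HB.instance Definition _ D := GRing.isZmodMorphism.Build
  (quadfield D) algC qembC (@qembC_is_zmod_morphism D).
HB.instance Definition _ D := GRing.isMonoidMorphism.Build
  (quadfield D) algC qembC (@qembC_is_monoid_morphism D).

Lemma in_OK_Aint D (x : quadfield D) : in_OK x -> qembC x \in Aint.
Proof.
case=> p p_monic px; apply: (@root_monic_Aint (map_poly intr p)).
- have := rmorph_root (@qembC D) px; rewrite -map_poly_comp.
  by rewrite (eq_map_poly (g := intr)) // => z; rewrite /= rmorph_int.
- exact: monic_map.
- by apply/polyOverP => i; rewrite coef_map intr_int.
Qed.

Lemma in_OK_conj D (x : quadfield D) : in_OK x -> in_OK (qconj x).
Proof.
case=> p p_monic px; exists p => //.
have := rmorph_root (@qconj D) px; rewrite -map_poly_comp.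
by rewrite (eq_map_poly (g := intr)) // => z; rewrite /= rmorph_int.
Qed.

Definition omega (D : nat) : quadfield D :=
  if (D %% 4 == 1)%N then Quad D 2^-1 2^-1 else Quad D 0 1.

Lemma quad_int D (c : int) : c%:~R = Quad D c%:~R 0.
Proof.
have natE n : n%:R = Quad D n%:R 0.
  by elim: n => // n IHn; rewrite !mulrS IHn; apply: quad_eqP.
case: c => n; first exact: natE.
by rewrite NegzE !rmorphN /= -!pmulrn natE; apply: quad_eqP => //=; rewrite oppr0.
Qed.

(** Trace and norm are rational algebraic integers, hence integers. Then [D * (2 * qirr x) ^+ 2],
    the squared trace minus four times the norm, is an integer, so both coordinates are
    half-integers; congruences modulo 4 settle their parities. *)
Lemma in_OK_coordinates D (x : quadfield D) : squarefree D -> in_OK x ->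
  exists a b : int, x = a%:~R + b%:~R * omega D.
Proof.
move=> sqfD xO.
have xA := in_OK_Aint _ _ xO; have x'A := in_OK_Aint _ _ (in_OK_conj _ _ xO).
have rat_int (q : rat) : ratr q \in Aint -> q \is a Num.int.
  by move=> qA; rewrite -Cint_rat; apply: Cint_rat_Aint => //; apply: Crat_rat.
have trZ : 2 * qrat x \is a Num.int.
  apply: rat_int.
  suff -> : ratr (2 * qrat x) = qembC x + qembC (qconj x) by exact: rpredD.
  by rewrite /qembC /= rmorphN rmorphM /= ratr_nat; ring.
have nmZ : qrat x ^+ 2 - D%:R * qirr x ^+ 2 \is a Num.int.
  apply: rat_int; set q := (_ - _).
  suff -> : ratr q = qembC x * qembC (qconj x) by exact: rpredM.
  rewrite /qembC /= !(rmorphN, rmorphD, rmorphM, rmorphXn) /= ratr_nat.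
  by rewrite -[D%:R in LHS]sqrtCK; ring.
have irZ : 2 * qirr x \is a Num.int.
  apply: (@rat_int_of_squarefree_sqr D) => //.
  have -> : D%:R * (2 * qirr x) ^+ 2 =
    (2 * qrat x) ^+ 2 - 4 * (qrat x ^+ 2 - D%:R * qirr x ^+ 2) by ring.
  by apply: rpredB; [exact: rpredX | exact: rpredM (rpred_nat _ _) _].
have [A eA] := intrP trZ; have [B eB] := intrP irZ; have [n en] := intrP nmZ.
have eq4 : A ^+ 2 - D%:Z * B ^+ 2 = 4 * n.
  apply/eqP; rewrite -(eqr_int rat) !(rmorphB, rmorphM, rmorphXn) /=.
  by rewrite -!pmulrn -eA -eB -en; apply/eqP; ring.
have xa : qrat x = A%:~R / 2 by rewrite -eA; field.
have xb : qirr x = B%:~R / 2 by rewrite -eB; field.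
have D40 : (D %% 4 != 0)%N by have := sqfD 2%N isT.
clear - eq4 xa xb D40.
have parity : if (D %% 4 == 1)%N then exists a, A = 2 * a + B
              else exists a b, A = 2 * a /\ B = 2 * b.
  move: (D %/ 4)%N (D %% 4)%N (divn_eq D 4) (ltn_pmod D (isT : 0 < 4)%N) D40 eq4.
  move=> d c -> c4 c0 {xa xb}.
  have [r [a0 [-> r01]]] : exists r a0 : int, A = 2 * a0 + r /\ (r = 0 \/ r = 1).
    by exists (A %% 2)%Z, (A %/ 2)%Z; lia.
  have [r' [b0 [-> r'01]]] : exists r a0 : int, B = 2 * a0 + r /\ (r = 0 \/ r = 1).
    by exists (B %% 2)%Z, (B %/ 2)%Z; lia.
  (* With [A = 2 a0 + r], [B = 2 b0 + r'] and [D = 4 d + c], all terms other than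
     [r ^+ 2 - c * r' ^+ 2] are multiples of 4, which leaves finitely many residues to check. *)
  move=> eq4; have {}eq4 : r ^+ 2 - c%:Z * r' ^+ 2 = 4 * (n - a0 ^+ 2 - a0 * r
      + (d * 4 + c)%N%:Z * (b0 ^+ 2 + b0 * r') + d%:Z * r' ^+ 2).
    by move: eq4; rewrite PoszD PoszM => eq4; lia.
  have rr' : if (c == 1)%N then r = r' else r = 0 /\ r' = 0.
    move: eq4; set k := (_ + d%:Z * _); move: k => k.
    by case: r01 r'01 => -> [] ->; case: ifP; lia.
  case: ifP rr' => _ rr'; first by exists (a0 - b0); lia.
  by exists a0, b0; lia.
rewrite /omega; case: ifP parity => _.
  case=> a eAB; exists a, B; rewrite !quad_int.
  by apply: quad_eqP; rewrite /= ?xa ?xb ?eAB ?rmorphD ?rmorphM /=; field.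
case=> a [b [eA2 eB2]]; exists a, b; rewrite !quad_int.
by apply: quad_eqP; rewrite /= ?xa ?xb ?eA2 ?eB2 ?rmorphM /=; field.
Qed.

Lemma in_OK_quadratic D (x : quadfield D) (b c : int) :
  x ^+ 2 = b%:~R * x + c%:~R -> in_OK x.
Proof.
move=> xE; exists ('X^2 - (b%:P * 'X + c%:P)).
  rewrite monicE lead_coefDl ?lead_coefXn // size_polyN size_polyXn.
  by rewrite size_MXaddC; case: ifP => // _; rewrite !ltnS; exact: size_polyC_leq1.
rewrite /root !(rmorphB, rmorphD, rmorphM, rmorphXn) /= map_polyX !map_polyC /=.
by rewrite !hornerE -expr2 xE subrr.
Qed.

Lemma omega_trace_norm D : exists t n : int,
  omega D + qconj (omega D) = t%:~R /\ omega D * qconj (omega D) = n%:~R.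
Proof.
rewrite /omega; case: ifP => D41; last first.
  exists 0, (- D%:Z); rewrite !quad_int.
  by split; apply: quad_eqP => /=; rewrite ?rmorphN /= -?pmulrn; ring.
have DE : D%:R = 4 * (D %/ 4)%N%:R + 1 :> rat.
  by rewrite {1}(divn_eq D 4) (eqP D41) natrD natrM; ring.
(* The norm of [(1 + sqrt D) / 2] is [(1 - D) / 4], and [D = 4 (D %/ 4) + 1]. *)
exists 1, (- (D %/ 4)%N%:Z); rewrite !quad_int.
by split; apply: quad_eqP => /=; rewrite ?rmorphN /= -?pmulrn ?DE; field.
Qed.

(** Converse of [in_OK_coordinates]: [omega] is a root of [X^2 - t X + n], with [t] its trace and
    [n] its norm. *)
Lemma in_OK_lattice D (a b : int) : in_OK (a%:~R + b%:~R * omega D).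
Proof.
apply: integral_add; first exact: integral_id.
apply: integral_mul; first exact: integral_id.
have [t [n [tE nE]]] := omega_trace_norm D.
by apply: (@in_OK_quadratic _ _ t (- n)); rewrite rmorphN /= -tE -nE; ring.
Qed.

Lemma in_OKMz D (x : quadfield D) (k : int) : in_OK x -> in_OK (x *~ k).
Proof. by move=> xO; rewrite -mulrzr; apply: integral_mul xO (integral_id _ _). Qed.

Lemma qconjK D : involutive (@qconj D).
Proof. by move=> x; apply: quad_eqP => //=; rewrite opprK. Qed.

(** * The area form, traces and norms on the embedded lattice *)

Section Lattice.
Variables (R : realType) (D : nat).
Hypotheses (D_gt1 : (1 < D)%N) (D_sqfree : squarefree D).
Local Notation K := (quadfield D).
Local Notation "x ^e" := (qemb R x) (at level 2).
Local Notation "x ^e'" := (qemb R (qconj x)) (at level 2).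
Local Notation s := (Num.sqrt (disc D)%:R : R).

(** A determinant of the two real embeddings, signed so that it is positive for totally positive
    [x], [y] when [y] has the larger ratio of first to second embedding. *)
Definition area (x y : K) : R := y^e * x^e' - x^e * y^e'.

Lemma omega_diff : (omega D)^e - (omega D)^e' = s.
Proof.
have half : ratr (2^-1 : rat) = 2^-1 :> R by rewrite fmorphV rmorph_nat.
rewrite /omega /disc; case: ifP => _; rewrite /qemb /= rmorphN /=.
  by rewrite half; field.
rewrite natrM sqrtrM ?ler0n // (_ : 4 = 2 ^+ 2) ?sqrtr_sqr ?ger0_norm //;
  by rewrite ?rmorph1 ?rmorph0; ring.
Qed.

Lemma area_lattice (a b c d : int) :
  area (a%:~R + b%:~R * omega D) (c%:~R + d%:~R * omega D)
  = (a * d - b * c)%:~R * s.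
Proof.
by rewrite -omega_diff /area !(rmorphD, rmorphM, rmorphB, rmorphN, rmorph_int) /=; ring.
Qed.

Lemma trace_int (x : K) : in_OK x -> exists t : int, x^e + x^e' = t%:~R.
Proof.
move=> /in_OK_coordinates[//|a [b ->]]; have [t [_ [tE _]]] := omega_trace_norm D.
exists (2 * a + b * t); rewrite !(rmorphD, rmorphM, rmorph_int) /=.
by have /(congr1 (@qemb _ R)) := tE; rewrite !(rmorphD, rmorph_int) /= => <-; ring.
Qed.

Lemma norm_int (x : K) : in_OK x -> exists n : int, x^e * x^e' = n%:~R.
Proof.
move=> /in_OK_coordinates[//|a [b ->]]; have [t [n [tE nE]]] := omega_trace_norm D.
exists (a ^+ 2 + a * b * t + b ^+ 2 * n); rewrite !(rmorphD, rmorphM, rmorph_int) /=.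
have /(congr1 (@qemb _ R)) := tE; rewrite !(rmorphD, rmorph_int) /= => <-.
have /(congr1 (@qemb _ R)) := nE; rewrite !(rmorphM, rmorph_int) /= => <-.
ring.
Qed.

Lemma qemb_qconj_inj : injective (fun x : K => x^e').
Proof.
move=> x y /(qemb_inj D_gt1 D_sqfree) /(congr1 (@qconj D)).
by rewrite !qconjK.
Qed.

Lemma norm_ge1 (x : K) : in_OK x -> x != 0 -> 1 <= `|x^e * x^e'|.
Proof.
move=> xO x0; have [n nE] := norm_int _ xO; rewrite nE -intr_norm ler1z.
have : x^e * x^e' != 0.
  rewrite mulf_neq0 //; apply: contraNneq x0 => e0; apply/eqP.
    by apply: (qemb_inj D_gt1 D_sqfree (R := R)); rewrite e0 rmorph0.
  by apply: qemb_qconj_inj; rewrite e0 !rmorph0.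
by rewrite nE intr_eq0; lia.
Qed.

Lemma sqrt_disc_gt1 : 1 < s.
Proof.
rewrite -[X in X < _](sqrtr1 R) ltr_sqrt ?ltr0n ?ltr1n /disc; case: ifP => _ //; lia.
Qed.

(** * Existence of decompositions *)

Lemma indecomposable_split (x y z : K) : indecomposable R x ->
  in_OKplus R y -> in_OKplus R z -> x <> y + z.
Proof. by move=> [_ x_indec] yP zP xE; apply: x_indec; exists y, z. Qed.

Lemma trace_ge1 (x : K) : in_OKplus R x -> 1 <= x^e + x^e'.
Proof.
move=> [xO x1 x2]; have [t tE] := trace_int _ xO.
have : 0 < x^e + x^e' by exact: addr_gt0.
by rewrite tE ltr0z ler1z; lia.
Qed.

(** Induction on an integer bound for the trace: each summand of a splitting has trace at least 1,
    so the other one's trace drops by at least 1. *)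
Lemma decomposition_exists (x : K) : in_OKplus R x ->
  exists t, is_decomposition R x t.
Proof.
move=> xP; have [n] : exists n : nat, x^e + x^e' <= n%:R.
  have [xO x1 x2] := xP; have [t tE] := trace_int _ xO.
  by exists `|t|%N; rewrite tE pmulrn abszE ler_int ler_norm.
elim: n x xP => [|n IHn] x xP tr_x.
  by have := trace_ge1 _ xP; lra.
have [x_indec|x_dec] := EM (indecomposable R x).
  by exists [:: x]; split=> [y|]; rewrite ?big_seq1 // inE => /eqP->.
have [y [z [yP zP xE]]] : exists y z, [/\ in_OKplus R y, in_OKplus R z & x = y + z].
  by apply: contra_notP x_dec => noyz; split.
have := trace_ge1 _ yP; have := trace_ge1 _ zP; move: tr_x.
rewrite xE !rmorphD /= mulrS => tr_x tr_z tr_y.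
have [|ty [tyP tyE]] := IHn y yP; first by lra.
have [|tz [tzP tzE]] := IHn z zP; first by lra.
exists (ty ++ tz); split; last by rewrite big_cat /= tyE tzE.
by move=> w; rewrite mem_cat => /orP[/tyP|/tzP].
Qed.

(** * Linearity of the area form *)

Lemma areaD (x y z : K) : area x (y + z) = area x y + area x z.
Proof. by rewrite /area !rmorphD /=; ring. Qed.

Lemma qembMz (x : K) (k : int) : (x *~ k)^e = k%:~R * x^e.
Proof. by rewrite -mulrzr rmorphM rmorph_int mulrC. Qed.

Lemma qemb_qconjMz (x : K) (k : int) : (x *~ k)^e' = k%:~R * x^e'.
Proof. by rewrite -mulrzr !rmorphM !rmorph_int mulrC. Qed.

Lemma areaMz (x y : K) (k : int) : area x (y *~ k) = k%:~R * area x y.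
Proof. by rewrite /area qembMz qemb_qconjMz; ring. Qed.

Lemma areaxx (x : K) : area x x = 0.
Proof. by rewrite /area subrr. Qed.

Lemma area_sum (x : K) (t : seq K) :
  area x (\sum_(z <- t) z) = \sum_(z <- t) area x z.
Proof.
elim: t => [|z t IHt]; rewrite ?big_nil ?big_cons ?areaD ?IHt //.
by rewrite /area !rmorph0 /=; ring.
Qed.

Lemma qembMn (x : K) (n : nat) : (x *+ n)^e = n%:R * x^e.
Proof. by rewrite -[x *+ n]mulr_natl rmorphM rmorph_nat. Qed.

Lemma qemb_qconjMn (x : K) (n : nat) : (x *+ n)^e' = n%:R * x^e'.
Proof. by rewrite -[x *+ n]mulr_natl !rmorphM !rmorph_nat. Qed.

(** * Lattice bases through an indecomposable, and the bound on its norm *)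

(** The coordinates of [x] are coprime, for [x = g w] with [g > 1] would split as [w + (g - 1) w]. A
    Bezout relation then completes [x] to a basis. *)
Lemma indecomposable_basis (x : K) : indecomposable R x ->
  exists y : K, [/\ in_OK y, area x y = s &
    forall z : K, in_OK z -> exists j k : int, z = x *~ j + y *~ k].
Proof.
move=> x_indec; have [[xO x1 x2] _] := x_indec.
have [a [b xE]] := in_OK_coordinates _ _ D_sqfree xO.
have [u [v uvE]] := Bezoutz a b.
have g1 : gcdz a b = 1.
  have /dvdzP[a' aE] := dvdz_gcdl a b.
  have /dvdzP[b' bE] := dvdz_gcdr a b.
  move: aE bE; have : 0 <= gcdz a b by [].
  move: (gcdz a b) => g g0 aE bE; have [//|g_neq1] := eqVneq g 1.
  pose w : K := a'%:~R + b'%:~R * omega D.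
  have xw : x = w *~ g by rewrite xE /w aE bE -[RHS]mulrzr !rmorphM /=; ring.
  have wO : in_OK w by exact: in_OK_lattice.
  move: x1 x2; rewrite xw qembMz qemb_qconjMz => x1 x2.
  have g_gt0 : 0 < g.
    by rewrite lt_def g0 andbT; apply: contraTneq x1 => ->; rewrite mul0r ltxx.
  have gR : 0 < g%:~R :> R by rewrite ltr0z.
  rewrite !pmulr_rgt0 // in x1 x2.
  have g1R : 0 < (g - 1)%:~R :> R by rewrite ltr0z; lia.
  case: (@indecomposable_split x w (w *~ (g - 1)) x_indec) => //.
    split; [exact: in_OKMz | rewrite qembMz | rewrite qemb_qconjMz]; exact: mulr_gt0.
  by rewrite xw mulrzBr addrC subrK.
(* Its coordinate determinant with [x] is [a u + b v = 1]. *)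
exists ((- v)%:~R + u%:~R * omega D); split; first exact: in_OK_lattice.
  rewrite xE area_lattice (_ : a * u - b * - v = 1) ?mul1r //.
  by rewrite -g1 -uvE; ring.
move=> z /(in_OK_coordinates _ _ D_sqfree)[p [q ->]].
(* Cramer's rule for a matrix of determinant 1. *)
exists (p * u + q * v), (a * q - b * p).
rewrite -[x *~ _]mulrzr -[_ *~ (a * _ - _)]mulrzr xE.
rewrite g1 in uvE; have /(congr1 (intr : int -> K)) := uvE.
rewrite !(rmorphD, rmorphB, rmorphM, rmorph1) /= => uvK.
by rewrite -[LHS]mulr1 -[X in _ * X = _]uvK; ring.
Qed.

Lemma basis_shift (x y : K) : in_OKplus R x -> in_OK y -> area x y = s ->
  exists z : K, [/\ in_OK z, area x z = s & 0 < z^e' <= x^e'].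
Proof.
(* Multiples of [x] do not change the area. Using the ceiling minus 1, not the floor, puts the
   remainder in the interval open at 0, so the new conjugate is strictly positive. *)
move=> [xO x1 x2] yO yE; pose t := Num.ceil (y^e' / x^e') - 1.
exists (y + x *~ (- t)); split.
- by apply: integral_add yO _; apply: in_OKMz.
- by rewrite areaD areaMz areaxx mulr0 addr0.
rewrite rmorphD rmorphD /= qemb_qconjMz rmorphN /=.
have := ceil_itv (y^e' / x^e'); rewrite -/t ltr_pdivlMr // ler_pdivrMr //.
have -> : Num.ceil (y^e' / x^e') = t + 1 by rewrite /t; ring.
rewrite [(t + 1)%:~R]rmorphD /= => /andP[le1 le2]; apply/andP; split; lra.
Qed.

(* With [y] as in [basis_shift], [N (y - x) <= -1], while AM-GM gives
   [- 4 N x N (y - x) <= (area x (y - x)) ^ 2 = s ^ 2]. *)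
Lemma norm_indecomposable (x : K) : indecomposable R x ->
  4 * (x^e * x^e') <= s ^+ 2.
Proof.
move=> x_indec; have [xP _] := x_indec; have [xO x1 x2] := xP.
have [y0 [y0O y0E _]] := indecomposable_basis _ x_indec.
have [y [yO yE /andP[y2 y2x]]] := basis_shift _ _ xP y0O y0E.
have s1 := sqrt_disc_gt1.
have y1 : 0 < y^e.
  rewrite -(pmulr_lgt0 _ x2); move: yE; rewrite /area.
  by have := mulr_gt0 x1 y2; lra.
(* Otherwise [x = y + (x - y)] is a splitting, unless the conjugates agree, and then the area would
   be nonpositive. *)
have yx1 : x^e <= y^e.
  rewrite leNgt; apply/negP => yx1.
  move: y2x; rewrite le_eqVlt => /orP[/eqP e2|yx2].
    move: yE; rewrite /area e2 -mulrBl.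
    have : (y^e - x^e) * x^e' <= 0 by rewrite pmulr_lle0 //; lra.
    by lra.
  apply: (@indecomposable_split x y (x - y)) => //; last by ring.
  split; first exact: integral_sub.
    by rewrite rmorphB subr_gt0.
  by rewrite !rmorphB /= subr_gt0.
have yx0 : y - x != 0.
  apply: contraTneq s1 => /subr0_eq e; move: yE; rewrite e areaxx => <-.
  by rewrite ltr10.
have := norm_ge1 _ (integral_sub yO xO) yx0.
rewrite !rmorphB /= ler0_norm; last by rewrite mulr_ge0_le0 //; lra.
move: yE; rewrite /area => sE nm1.
have : x^e * x^e' <= (y^e - x^e) * (x^e' - y^e') * (x^e * x^e').
  rewrite ler_peMl //; last by lra.
  by rewrite mulr_ge0 // ltW.
have := sqr_ge0 ((y^e - x^e) * x^e' - x^e * (x^e' - y^e')).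
rewrite -sE; nra.
Qed.

(** * Consequences of unique decomposability *)

(** Exchange argument: replacing the summands selected by [P] with decompositions of [x] and [y]
    gives another decomposition of [a]. By uniqueness and cancellation of the rest, the new summands
    are the selected ones, permuted. *)
Lemma unique_decomposition_split (a x y : K) (l : seq K) (P : pred K) :
    is_decomposition R a l ->
    (forall t, is_decomposition R a t -> perm_eq l t) ->
    in_OKplus R x -> in_OKplus R y -> \sum_(z <- l | P z) z = x + y ->
  exists2 t : seq K, (forall z, z \in t -> P z) & \sum_(z <- t) z = x.
Proof.
move=> [lI lE] l_uniq xP yP xyE.
have [tx [txI txE]] := decomposition_exists _ xP.
have [ty [tyI tyE]] := decomposition_exists _ yP.
have perm_P : perm_eq (filter P l ++ filter (predC P) l) l.
  by rewrite perm_filterC.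
have /l_uniq : is_decomposition R a ((tx ++ ty) ++ filter (predC P) l).
  split=> [z|].
    rewrite !mem_cat => /orP[/orP[/txI|/tyI]|] //.
    by rewrite mem_filter => /andP[_ /lI].
  by rewrite !big_cat /= txE tyE -xyE big_filter -lE [RHS](bigID P).
rewrite -(permPl perm_P) perm_cat2r => perm_t.
exists tx => // z z_tx.
have : z \in tx ++ ty by rewrite mem_cat z_tx.
by rewrite -(perm_mem perm_t) mem_filter => /andP[].
Qed.

Lemma sum_pred1_seq (l : seq K) (x : K) :
  \sum_(z <- l | z == x) z = x *+ count_mem x l.
Proof.
elim: l => [|y l IHl]; rewrite ?big_nil ?big_cons //= IHl.
by case: eqP => [->|_] //; rewrite mulrS.
Qed.

Lemma sum_pred2_seq (l : seq K) (x y : K) : x != y ->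
  \sum_(z <- l | z \in [:: x; y]) z = x *+ count_mem x l + y *+ count_mem y l.
Proof.
move=> xy; rewrite (bigID (pred1 x)) /= -!sum_pred1_seq.
congr (_ + _); apply: eq_bigl => z; rewrite !inE.
  by case: eqP; rewrite ?andbF.
by case: eqP => [->|_] /=; rewrite ?andbT ?andbF ?(negPf xy).
Qed.

Lemma count_decomposition (a x : K) (l : seq K) :
    is_decomposition R a l ->
    (forall t, is_decomposition R a t -> perm_eq l t) -> x \in l ->
  ((count_mem x l)%:R - 1) * (x^e * x^e') <= s.
Proof.
move=> la l_uniq xl; have x_indec := la.1 _ xl; have [xP _] := x_indec.
have [xO x1 x2] := xP; have x12 := mulr_gt0 x1 x2.
have [y0 [y0O y0E _]] := indecomposable_basis _ x_indec.
have [y [yO yE /andP[y2 y2x]]] := basis_shift _ _ xP y0O y0E.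
have s1 := sqrt_disc_gt1.
rewrite leNgt; apply/negP; set n := count_mem x l => n_large.
(* For [n <= 1] the left side is at most 0, below [s]. *)
have n2 : 2 <= n%:R :> R.
  rewrite ler_nat; case: n n_large => [|[|n]] //; rewrite ?subrr ?mul0r; lra.
have sE : y^e * x^e' = s + x^e * y^e' by rewrite -yE /area; ring.
have y2x1 : x^e * y^e' <= x^e * x^e' by rewrite ler_pM2l.
have y12 : 0 < x^e * y^e' by exact: mulr_gt0.
have yP : in_OKplus R y.
  by split=> //; rewrite -(pmulr_lgt0 _ x2) sE; lra.
have nxyP : in_OKplus R (x *+ n - y).
  split.
  - by apply: integral_sub yO; rewrite pmulrn; exact: in_OKMz.
  (* Multiplied by [x^e'], this coordinate is at least [(n - 1) N x - s], since
     [x^e * y^e' <= N x]. *)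
  - rewrite rmorphB /= qembMn -(pmulr_lgt0 _ x2) mulrBl sE; nra.
  - rewrite !rmorphB /= qemb_qconjMn; nra.
(* By exchange [y] is a sum of copies of [x], so its area with [x] would be 0 instead of [s]. *)
have [|t tx tE] := @unique_decomposition_split a y (x *+ n - y) l (pred1 x)
  la l_uniq yP nxyP.
  by rewrite /= sum_pred1_seq addrC subrK.
move: yE; rewrite -tE area_sum big_seq big1 => [s0|z /tx /eqP->]; last exact: areaxx.
by move: s1; rewrite -s0 ltr10.
Qed.

(* If [area x y = k s] with [k > 1] then [x], [y] span a proper sublattice, and some
   lattice point [w] outside it lies in the parallelogram on [x], [y]. *)
Lemma area_decomposition (a x y : K) (l : seq K) :
    is_decomposition R a l ->
    (forall t, is_decomposition R a t -> perm_eq l t) ->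
    x \in l -> y \in l -> 0 < area x y ->
  area x y = s.
Proof.
move=> la l_uniq xl yl xy_gt0; have x_indec := la.1 _ xl; have [xP _] := x_indec.
have [xO x1 x2] := xP; have [[yO y1 y2] _] := la.1 _ yl.
have xy : x != y by apply: contraTneq xy_gt0 => ->; rewrite areaxx ltxx.
have [v [vO vE v_basis]] := indecomposable_basis _ x_indec.
have s1 := sqrt_disc_gt1; have s0 : 0 < s by lra.
have [j [k yE]] := v_basis _ yO.
have xyE : area x y = k%:~R * s by rewrite yE areaD !areaMz areaxx vE; ring.
have k_gt0 : 0 < k by move: xy_gt0; rewrite xyE pmulr_lgt0 // ltr0z.
have kR : 1 <= k%:~R :> R by rewrite ler1z -gtz0_ge1.
have k0R : 0 < k%:~R :> R by rewrite ltr0z.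
(* Since [y = j x + k v], rounding [j / k] up turns [v] into [w = u x + y / k] with [0 <= u < 1], a
   point of the parallelogram. *)
pose u : R := (Num.ceil (j%:~R / k%:~R : R))%:~R - j%:~R / k%:~R.
have /andP[u0 u1] : 0 <= u < 1.
  have := ceil_itv (j%:~R / k%:~R : R); rewrite /u rmorphB /= => /andP[? ?].
  by apply/andP; split; lra.
pose w := v + x *~ Num.ceil (j%:~R / k%:~R : R).
have wO : in_OK w by apply: integral_add vO _; exact: in_OKMz.
have w1E : w^e = u * x^e + y^e / k%:~R.
  by rewrite [in RHS]yE /w !rmorphD /= !qembMz /u; field; lra.
have w2E : w^e' = u * x^e' + y^e' / k%:~R.
  by rewrite [in RHS]yE /w !rmorphD /= !qemb_qconjMz /u; field; lra.
have wE : area x w = s by rewrite areaD areaMz areaxx vE; ring.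
clearbody w.
have /andP[kV0 kV1] : 0 < (k%:~R : R)^-1 <= 1 by rewrite invr_gt0 invf_le1 k0R.
have wP : in_OKplus R w.
  by split=> //; rewrite ?w1E ?w2E; apply: ltr_wpDl; rewrite ?mulr_gt0 ?mulr_ge0 // ltW.
have m1 : 1 <= (count_mem x l)%:R :> R by rewrite ler1n -has_count has_pred1.
have n1 : 1 <= (count_mem y l)%:R :> R by rewrite ler1n -has_count has_pred1.
set m := count_mem x l in m1; set n := count_mem y l in n1.
have zP : in_OKplus R (x *+ m + y *+ n - w).
  split.
  - apply: integral_sub wO; rewrite !pmulrn.
    by apply: integral_add; exact: in_OKMz.
  - rewrite rmorphB rmorphD /= !qembMn w1E.
    have -> : m%:R * x^e + n%:R * y^e - (u * x^e + y^e / k%:~R) =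
      (m%:R - u) * x^e + (n%:R - k%:~R^-1) * y^e by ring.
    by apply: ltr_pwDl; [apply: mulr_gt0 => //; lra
                       | apply: mulr_ge0; [lra | exact: ltW]].
  - rewrite !rmorphB !rmorphD /= !qemb_qconjMn w2E.
    have -> : m%:R * x^e' + n%:R * y^e' - (u * x^e' + y^e' / k%:~R) =
      (m%:R - u) * x^e' + (n%:R - k%:~R^-1) * y^e' by ring.
    by apply: ltr_pwDl; [apply: mulr_gt0 => //; lra
                       | apply: mulr_ge0; [lra | exact: ltW]].
have [|t txy tE] := @unique_decomposition_split a w (x *+ m + y *+ n - w) l
  (mem [:: x; y]) la l_uniq wP zP.
  by rewrite /= sum_pred2_seq // [RHS]addrC subrK.
(* By exchange [w] is a sum of copies of [x] and [y]; [i] counts the copies of [y]. Hence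
   [s = i k s], which forces [k = 1]. *)
have [i iE] : exists i : nat, area x w = i%:R * area x y.
  rewrite -tE area_sum; elim: t txy {tE} => [|z t IHt] txy.
    by exists 0%N; rewrite big_nil mul0r.
  have [|i iE] := IHt; first by move=> z' z't; apply: txy; rewrite inE z't orbT.
  have : z \in [:: x; y] by apply: txy; rewrite mem_head.
  rewrite big_cons iE !inE => /orP[]/eqP->; first by exists i; rewrite areaxx add0r.
  by exists i.+1; rewrite mulrS; ring.
have ik : i%:Z * k = 1.
  apply/eqP; rewrite -(eqr_int R); apply/eqP.
  apply: (mulIf (lt0r_neq0 s0)); rewrite rmorphM /= -pmulrn mul1r -mulrA -xyE -iE.
  exact: wE.
have k_le1 : k <= 1.
  case: i ik {iE} => [|i]; first by rewrite mul0r.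
  by move=> <-; rewrite intS mulrDl mul1r lerDl mulr_ge0 // ltW.
have k_eq1 : k = 1 by apply/le_anti; rewrite k_le1 -gtz0_ge1.
by rewrite xyE k_eq1 mul1r.
Qed.

(** If both embeddings ordered [x] below [y], then [y = x + (y - x)] would be a splitting. *)
Lemma indecomposable_antitone (x y : K) :
  indecomposable R x -> indecomposable R y -> x != y -> x^e <= y^e ->
  x^e < y^e /\ y^e' < x^e'.
Proof.
move=> x_indec y_indec xy le_xy.
have [[xO x1 x2] _] := x_indec; have [[yO y1 y2] _] := y_indec.
have lt_xy : x^e < y^e.
  rewrite lt_neqAle le_xy andbT; apply: contraNneq xy => e.
  exact/eqP/(qemb_inj D_gt1 D_sqfree e).
split=> //; rewrite ltNge; apply/negP => le_xy'.
have lt_xy' : x^e' < y^e'.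
  rewrite lt_neqAle le_xy' andbT; apply: contraNneq xy => e.
  by apply/eqP; apply: qemb_qconj_inj.
apply: (@indecomposable_split y x (y - x)) => //; last by rewrite addrC subrK.
split; first exact: integral_sub.
  by rewrite rmorphB subr_gt0.
by rewrite !rmorphB /= subr_gt0.
Qed.

Lemma seq_min_emb (l : seq K) : l != [::] ->
  exists2 x, x \in l & forall y, y \in l -> x^e <= y^e.
Proof.
elim: l => // y l IHl _; have [->|l0] := eqVneq l [::].
  by exists y; rewrite ?mem_head // => z; rewrite inE => /eqP->.
have [x xl x_min] := IHl l0; have [le_xy|lt_yx] := leP (x^e) (y^e).
  by exists x => [|z]; rewrite inE ?xl ?orbT // => /orP[/eqP->|/x_min].
exists y => [|z]; rewrite inE ?eqxx // => /orP[/eqP->|/x_min] //.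
exact: le_trans (ltW lt_yx).
Qed.

(** Take [x] with the least first embedding, so that every other summand has positive area with [x],
    hence area [s]. Two such summands differ by a multiple of [x], and indecomposability makes them
    equal. *)
Lemma unique_decomposition_shape (a : K) (l : seq K) : in_OKplus R a ->
    is_decomposition R a l ->
    (forall t, is_decomposition R a t -> perm_eq l t) ->
  exists2 x, x \in l &
    a = x *+ count_mem x l \/
    exists y, [/\ y \in l, area x y = s, y^e' < x^e', x^e < y^e &
      a = x *+ count_mem x l + y *+ count_mem y l].
Proof.
move=> aP la l_uniq; have [lI lE] := la.
have l0 : l != [::].
  case: aP => _ a0 _; apply: contraTneq a0 => l0.
  by rewrite -lE l0 big_nil rmorph0 ltxx.
have [x xl x_min] := seq_min_emb _ l0; exists x => //.
have x_indec := lI _ xl; have [[xO x1 x2] _] := x_indec.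
have other y : y \in l -> y != x ->
    [/\ area x y = s, y^e' < x^e' & x^e < y^e].
  move=> yl yx; have [|lt1 lt2] :=
    indecomposable_antitone _ _ x_indec (lI _ yl) _ (x_min _ yl).
    by rewrite eq_sym.
  split=> //; apply: (area_decomposition _ _ _ _ la) => //.
  by rewrite subr_gt0 ltr_pM // ltW; have [[]] := lI _ yl.
have [all_x|] := boolP (all (pred1 x) l).
  left; rewrite -sum_pred1_seq -lE big_seq [RHS]big_seq_cond.
  by apply: eq_bigl => z; case: (boolP (z \in l)) => // /(allP all_x) /= ->.
case/allPn => y yl /= yx; right; exists y; have [xyE lt2 lt1] := other _ yl yx.
split=> //; rewrite -sum_pred2_seq 1?eq_sym // -lE big_seq [RHS]big_seq_cond.
apply: eq_bigl => z; case: (boolP (z \in l)) => //= zl; rewrite !inE.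
have [//|zx] := eqVneq z x; rewrite /=; apply/esym/eqP.
have [xzE _ _] := other _ zl zx.
have [v [vO vE v_basis]] := indecomposable_basis _ x_indec.
have zyO : in_OK (z - y).
  by apply: integral_sub; [have [[]] := lI _ zl | have [[]] := lI _ yl].
have [j [k zyE]] := v_basis _ zyO.
have s1 := sqrt_disc_gt1.
have k0 : k = 0.
  have : area x (z - y) = 0 by have := areaD x (z - y) y; rewrite subrK xzE xyE; lra.
  rewrite zyE areaD !areaMz areaxx vE mulr0 add0r => /eqP.
  by rewrite mulf_eq0 intr_eq0 (gt_eqF (lt_trans ltr01 s1)) orbF => /eqP.
rewrite k0 mulr0z addr0 in zyE.
have posMz (i : int) : 0 < i -> in_OKplus R (x *~ i).
  move=> i0; split; first exact: in_OKMz.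
    by rewrite qembMz mulr_gt0 // ltr0z.
  by rewrite qemb_qconjMz mulr_gt0 // ltr0z.
(* Here [z - y = j x]: for nonzero [j], one of [y], [z] is the other plus a positive multiple of
   [x]. *)
case: (ltgtP j 0) => j0.
- case: (@indecomposable_split y z (x *~ (- j)) (lI _ yl)) => //.
  + by have [] := lI _ zl.
  + by apply: posMz; rewrite oppr_gt0.
  + by rewrite mulrNz -zyE; ring.
- case: (@indecomposable_split z y (x *~ j) (lI _ zl)) => //.
  + by have [] := lI _ yl.
  + exact: posMz.
  + by rewrite -zyE; ring.
- by apply/subr0_eq; rewrite zyE j0.
Qed.

(** * The final estimate *)

(** Here [n] is a multiplicity, [p] a norm and [t] is [sqrt Delta]. Use [n - 1 <= (n - 1) p] and
    [n p = (n - 1) p + p], then multiply the two bounds. *)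
Lemma multiple_bound (n p t : R) : 1 <= t -> 1 <= n -> 1 <= p ->
    (n - 1) * p <= t -> 4 * p <= t ^+ 2 ->
  [/\ n <= 1 + t, n * p <= t + t ^+ 2 / 4 &
      n ^+ 2 * p <= (1 + t) * (t + t ^+ 2 / 4)].
Proof.
move=> t1 n1 p1 np pt.
have nt : n <= 1 + t by nra.
have npt : n * p <= t + t ^+ 2 / 4 by lra.
by split=> //; rewrite expr2 -mulrA; apply: ler_pM; rewrite ?mulr_ge0; lra.
Qed.

Lemma unique_decomposition_norm (a : K) : in_OKplus R a ->
    uniquely_decomposable R a ->
  a^e * a^e' < s * (2 * s + 1) * (3 * s + 2).
Proof.
move=> aP [l [la l_uniq]]; have s1 := sqrt_disc_gt1.
have [x xl a_shape] := unique_decomposition_shape _ _ aP la l_uniq.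
have bound z : z \in l ->
    [/\ (count_mem z l)%:R <= 1 + s,
        (count_mem z l)%:R * (z^e * z^e') <= s + s ^+ 2 / 4 &
        (count_mem z l)%:R ^+ 2 * (z^e * z^e') <= (1 + s) * (s + s ^+ 2 / 4)].
  move=> zl; have z_indec := la.1 _ zl; have [[zO z1 z2] _] := z_indec.
  apply: multiple_bound => //.
  - exact: ltW.
  - by rewrite ler1n -has_count has_pred1.
  - have z0 : z != 0 by apply: contraTneq z1 => ->; rewrite rmorph0 ltxx.
    by have := norm_ge1 _ zO z0; rewrite gtr0_norm ?mulr_gt0.
  - exact: (count_decomposition a).
  - exact: norm_indecomposable.
have [[xO x1 x2] _] := la.1 _ xl.
have [m1 m2 m3] := bound _ xl; move: m1 m2 m3 a_shape.
have : 0 <= (count_mem x l)%:R :> R by [].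
move: (count_mem x l) => m; move: (m%:R) (qembMn x m) (qemb_qconjMn x m) => M xmE xmE'.
move=> M0 m1 m2 m3 [aE|[y [yl xyE lt2 lt1 aE]]].
  rewrite aE xmE xmE' (_ : _ * _ = M ^+ 2 * (x^e * x^e')); last by ring.
  by apply: le_lt_trans m3 _; nra.
have [[yO y1 y2] _] := la.1 _ yl.
have [n1 _ n3] := bound _ yl; move: n1 n3 aE.
have : 0 <= (count_mem y l)%:R :> R by [].
move: (count_mem y l) => n; move: (n%:R) (qembMn y n) (qemb_qconjMn y n) => N ynE ynE'.
move=> N0 n1 n3 aE.
have xyE' : y^e * x^e' = s + x^e * y^e' by rewrite -xyE /area; ring.
(* In the expanded norm the larger cross term [y^e * x^e'] is traded for [s + x^e * y^e']. *)
have NE : a^e * a^e' = M ^+ 2 * (x^e * x^e') + N ^+ 2 * (y^e * y^e')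
    + (N * M * s + 2 * (N * (M * (x^e * y^e')))).
  rewrite aE !rmorphD /= xmE xmE' ynE ynE' -xyE /area; ring.
have cross1 : N * M * s <= (1 + s) * (1 + s) * s.
  by rewrite ler_wpM2r ?ler_pM //; lra.
(* As [y^e' < x^e'], the product [x^e * y^e'] is at most the norm of [x], so [m2] applies. *)
have cross2 : N * (M * (x^e * y^e')) <= (1 + s) * (s + s ^+ 2 / 4).
  apply: ler_pM => //; first by rewrite !mulr_ge0 // ltW.
  by apply: le_trans m2; rewrite ler_wpM2l // ler_wpM2l // ltW.
(* The left side is the sum of the bounds for all terms of [NE]; the two sides differ by
   [s (4 s^2 - 3)], positive for [s > 1]. *)
have s3 : (1 + s) * s * (2 * s + 5) < s * (2 * s + 1) * (3 * s + 2) by nra.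
apply: le_lt_trans s3; rewrite NE; nra.
Qed.

End Lattice.

Theorem theorem5p4 (R : realType) (D : nat) (D_ge2 : (2 <= D)%N)
    (D_sqfree : squarefree D) (alpha : quadfield D)
    (alpha_pos : in_OKplus R alpha)
    (alpha_ud : uniquely_decomposable R alpha) :
  let sqrtDelta : R := Num.sqrt (disc D)%:R in
  qemb R (qnorm alpha) <
    sqrtDelta * (2 * sqrtDelta + 1) * (3 * sqrtDelta + 2).
Proof.
by rewrite /qnorm rmorphM; exact: unique_decomposition_norm.
Qed.
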